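(* The set $\mathcal{B}_{2d}$ is a set of fundamental invariants of $\overline{D_{2d}}$, i.e. it is a minimal set of generators of the $k$-algebra $R^{\overline{D_{2d}}}$.
   Context: Let $k$ be an algebraically closed field of characteristic zero and $R=k[x_0,x_1,x_2]$ with its standard grading. Fix integers $d\ge 3$ and $0<a<\frac d2$ with $\gcd(a,d)=1$, a primitive $2d$-th root of unity $\varepsilon\in k$, and set $e=\varepsilon^2$. The dihedral group $D_{2d}=\langle \tau,\eta \mid \tau^d=\eta^2=(\eta\tau)^2=1\rangle$ of order $2d$ acts linearly on $R$ through the representation $\rho_a:D_{2d}\to \mathrm{GL}(3,k)$ with $\rho_a(\tau)=\mathrm{diag}(1,e^a,e^{d-a})$ and $\rho_a(\eta)$ the permutation matrix fixing $x_0$ and interchanging $x_1$ and $x_2$. Identify $D_{2d}$ with its image. Let $C_{2d}$ be the cyclic group of order $2d$ generated by $\varepsilon\,\mathrm{Id}$ and let $\overline{D_{2d}}=D_{2d}\times C_{2d}\subset \mathrm{GL}(3,k)$ be the subgroup generated by $D_{2d}$ and $C_{2d}$. Let $\Gamma=\langle \mathrm{diag}(1,e,e^{d-1})\rangle\subset\mathrm{GL}(3,k)$; it coincides with $\langle\rho_a(\tau)\rangle$. For a group $G$, $R^G$ denotes the ring of invariants. The set $\mathcal{B}_{2d}$ consists of: (i) the $d+1$ monomials $x_0^{2d-2i}x_1^ix_2^i$, $0\le i\le d$; and (ii) all binomials $x_0^{c_0}x_1^{c_1}x_2^{c_2}+x_0^{c_0}x_1^{c_2}x_2^{c_1}$ with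 $c_0+c_1+c_2=2d$, $c_1\neq c_2$ and $x_0^{c_0}x_1^{c_1}x_2^{c_2}\in R^{\Gamma}$. A set of fundamental invariants of a finite group $G\subset \mathrm{GL}(3,k)$ means a minimal set of generators of the $k$-algebra $R^G$. *)

(* Defs.v *)
From HB Require Import structures.
From mathcomp Require Import all_boot all_order all_algebra all_fingroup.
From mathcomp Require Import all_character.
From mathcomp Require Export mpoly.

Set Implicit Arguments.
Unset Strict Implicit.
Unset Printing Implicit Defensive.

Import GRing.Theory.
Local Open Scope ring_scope.

(* [D] is the dihedral group < tau, eta | tau^d = eta^2 = (eta tau)^2 = 1 >:
   the presented group has order 2d, so a group of order 2d generated by two
   elements satisfying the relations is that group. *)
Definition is_dihedral (gT : finGroupType) (D : {group gT}) (d : nat)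
    (tau eta : gT) : Prop :=
  [/\ D :=: <<[set tau; eta]>>%g,
      #|D| = (2 * d)%N,
      (tau ^+ d = 1)%g,
      (eta ^+ 2 = 1)%g
    & ((eta * tau) ^+ 2 = 1)%g].

Section Defs.

Variable k : closedFieldType.

Local Notation R := {mpoly k[3]}.

Definition x0 : R := 'X_(0 : 'I_3).
Definition x1 : R := 'X_(1 : 'I_3).
Definition x2 : R := 'X_(2%:R : 'I_3).

Definition mono (c0 c1 c2 : nat) : R := x0 ^+ c0 * x1 ^+ c1 * x2 ^+ c2.

Definition diag3 (u v w : k) : 'M[k]_3 := diag_mx (\row_j [:: u; v; w]`_j).

Definition rho_tau (e : k) (a d : nat) : 'M[k]_3 :=
  diag3 1 (e ^+ a) (e ^+ (d - a)).

Definition rho_eta : 'M[k]_3 := perm_mx (tperm (1 : 'I_3) (2%:R : 'I_3)).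

(* [rho] is the representation rho_a, determined by its values on the
   generators tau and eta. *)
Definition is_rho (gT : finGroupType) (D : {group gT}) (tau eta : gT)
    (e : k) (a d : nat) (rho : mx_representation k D 3) : Prop :=
  rho tau = rho_tau e a d /\ rho eta = rho_eta.

Definition rep_image (gT : finGroupType) (D : {group gT})
    (rho : mx_representation k D 3) (A : 'M[k]_3) : Prop :=
  exists2 g, g \in D & A = rho g.

(* Subgroup of GL(3, k) generated by a set of invertible matrices. *)
Inductive gen_group (S : 'M[k]_3 -> Prop) : 'M[k]_3 -> Prop :=
| gen_group_mem A of S A : gen_group S A
| gen_group_one : gen_group S 1%:M
| gen_group_mul A B of gen_group S A & gen_group S B : gen_group S (A *m B)
| gen_group_inv A of gen_group S A : gen_group S (invmx A).

Definition cyclic_group (A : 'M[k]_3) : 'M[k]_3 -> Prop :=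
  gen_group (fun B => B = A).

Definition Gamma (e : k) (d : nat) : 'M[k]_3 -> Prop :=
  cyclic_group (diag3 1 e (e ^+ d.-1)).

Definition C2d (eps : k) : 'M[k]_3 -> Prop := cyclic_group eps%:M.

Definition Dbar (gT : finGroupType) (D : {group gT})
    (rho : mx_representation k D 3) (eps : k) : 'M[k]_3 -> Prop :=
  gen_group (fun A => rep_image rho A \/ C2d eps A).

(* Linear substitution x_i |-> \sum_j A_ij x_j.  The transposed convention has
   the same invariants for every group above, as the generating matrices are
   symmetric. *)
Definition mx_act (A : 'M[k]_3) (f : R) : R :=
  f \mPo [tuple \sum_(j < 3) A i j *: 'X_j | i < 3].

Definition invariant (G : 'M[k]_3 -> Prop) (f : R) : Prop :=
  forall A, G A -> mx_act A f = f.

Inductive gen_algebra (S : R -> Prop) : R -> Prop :=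
| gen_algebra_mem f of S f : gen_algebra S f
| gen_algebra_const c : gen_algebra S c%:MP
| gen_algebra_add f g of gen_algebra S f & gen_algebra S g :
    gen_algebra S (f + g)
| gen_algebra_mul f g of gen_algebra S f & gen_algebra S g :
    gen_algebra S (f * g).

Definition generates_invariants (G : 'M[k]_3 -> Prop) (S : R -> Prop) : Prop :=
  forall f, gen_algebra S f <-> invariant G f.

Definition fundamental_invariants (G : 'M[k]_3 -> Prop) (B : R -> Prop) : Prop :=
  generates_invariants G B /\
  forall S : R -> Prop, (forall f, S f -> B f) -> generates_invariants G S ->
    forall f, B f -> S f.

Definition B2d (e : k) (d : nat) (f : R) : Prop :=
  (exists2 i : nat, (i <= d)%N & f = mono (2 * d - 2 * i) i i) \/
  (exists c0 c1 c2 : nat,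
    [/\ (c0 + c1 + c2 = 2 * d)%N,
        c1 <> c2,
        invariant (Gamma e d) (mono c0 c1 c2)
      & f = mono c0 c1 c2 + mono c0 c2 c1]).

End Defs.

(* Main.v *)
Require Import Defs.
From mathcomp Require Import all_boot all_order all_algebra all_fingroup.
From mathcomp Require Import all_character.
From mathcomp Require Import ring zify.

Import GRing.Theory.
Local Open Scope ring_scope.

(** The group is generated by a torus part, consisting of the diagonal matrices
    rho_a(tau) and eps Id, and by the transposition eta of x1 and x2.  The
    torus part only rescales monomials: since a is prime to d, a monomial
    x0^c0 x1^c1 x2^c2 is fixed exactly when 2d divides c0 + c1 + c2 and
    c1 = c2 mod d.  An invariant f is therefore a combination of such monomials,
    and writing f = (f + eta f) / 2 shows that the invariants are spanned by the
    sums of a fixed monomial and its mirror image.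

    Generation.  With u = x1 x2 and p_r = x1^(dr) + x2^(dr), such a sum is
    x0^p u^q p_r with p + 2q + dr = 2dt ([orbit_sum]).  For r = 0 one splits
    off factors x0^p' u^q' of degree 2d; for r = 1 one splits off
    x0^p' u^q' p_1 of degree 2d, which leaves the case r = 0; and p_2 itself has
    degree 2d.  Larger r are reached by the Newton-type recursion
      p_(r+2) = p_2 p_r - (x1^(dr) x2^(2d) + x1^(2d) x2^(dr)),
    whose correction term is a power of u times p_|r-2| ([gen_orbit_sum]).

    Minimality.  All members of B_2d are homogeneous of the same degree 2d, and
    each is determined by any one of its monomials ([B2d_determined]).  Given f
    in B_2d and a monomial m of f, the exponents distinct from m that are 0 or
    have degree at least 2d form a submonoid, so the polynomials supported on
    it form a subalgebra, and f is not in it.  A generating subset of B_2d thus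
    has a member with a monomial off this submonoid; having degree 2d, that
    monomial is m, so the member is f ([B2d_irredundant]). *)

(** * Monomials in three variables *)

Definition mnm3 (c0 c1 c2 : nat) : 'X_{1.. 3} :=
  [multinom nth 0%N [:: c0; c1; c2] i | i < 3].

Lemma mdeg_mnm3 c0 c1 c2 : mdeg (mnm3 c0 c1 c2) = (c0 + c1 + c2)%N.
Proof. by rewrite mdegE !big_ord_recl big_ord0 !mnmE /= addn0 addnA. Qed.

Lemma mnm3_eq c0 c1 c2 b0 b1 b2 :
  (mnm3 c0 c1 c2 == mnm3 b0 b1 b2) = [&& c0 == b0, c1 == b1 & c2 == b2].
Proof.
apply/eqP/and3P => [/mnmP eq_cb | [/eqP-> /eqP-> /eqP->] //].
by have:= (eq_cb 0, eq_cb 1, eq_cb 2%:R); rewrite !mnmE /= => -[[-> ->] ->].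
Qed.

Lemma mnm3_ext (m : 'X_{1.. 3}) : m = mnm3 (m 0) (m 1) (m 2%:R).
Proof.
apply/mnmP => i; rewrite mnmE; case: i => [[|[|[|//]]] lti] /=;
  by congr (m _); apply/val_inj.
Qed.

(** * Linear substitutions and invariance under generated groups *)

Section PolynomialActions.

Context {k : closedFieldType}.

Local Notation R := {mpoly k[3]}.

Implicit Type f : R.

Lemma monoE c0 c1 c2 : mono k c0 c1 c2 = 'X_[mnm3 c0 c1 c2].
Proof.
rewrite mpolyXE_id !big_ord_recl big_ord0 mulr1 !mnmE /= mulrA /mono /x0 /x1 /x2.
by do !congr (_ * _ ^+ _); congr 'X_(_); apply/val_inj.
Qed.

Lemma mcoeff_mono c0 c1 c2 m : (mono k c0 c1 c2)@_m = (mnm3 c0 c1 c2 == m)%:R.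
Proof. by rewrite monoE mcoeffX. Qed.

Lemma mpoly3E f :
  f = \sum_(m <- msupp f) f@_m *: mono k (m 0) (m 1) (m 2%:R).
Proof.
by rewrite {1}[f]mpolyE; apply: eq_bigr => m _; rewrite monoE -mnm3_ext.
Qed.

Lemma mx_actE (A : 'M[k]_3) f :
  mx_act A f =
    \sum_(m <- msupp f) f@_m *: mx_act A (mono k (m 0) (m 1) (m 2%:R)).
Proof.
rewrite /mx_act comp_mpolyEX; apply: eq_bigr => m _.
by rewrite monoE -mnm3_ext.
Qed.

Lemma mx_actX (A : 'M[k]_3) i : mx_act A 'X_i = \sum_(j < 3) A i j *: 'X_j.
Proof. by rewrite /mx_act comp_mpolyXU -tnth_nth tnth_mktuple. Qed.

Lemma mx_act_mul (A B : 'M[k]_3) f : mx_act (A *m B) f = mx_act B (mx_act A f).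
Proof.
rewrite /mx_act [in RHS](comp_mpolyE f) raddf_sum /= comp_mpolyE.
apply: eq_bigr => m _; rewrite comp_mpolyZ rmorph_prod /=; congr (_ *: _).
apply: eq_bigr => i _; rewrite rmorphXn /= !tnth_mktuple; congr (_ ^+ _).
rewrite raddf_sum /=.
under [RHS]eq_bigr do
  rewrite comp_mpolyZ comp_mpolyXU -tnth_nth tnth_mktuple scaler_sumr.
rewrite exchange_big /=; apply: eq_bigr => j _.
by rewrite mxE scaler_suml; apply: eq_bigr => l _; rewrite scalerA.
Qed.

Lemma mx_act1 f : mx_act 1%:M f = f.
Proof.
rewrite -[RHS]comp_mpoly_id /mx_act; congr (_ \mPo _).
apply: eq_from_tnth => i; rewrite !tnth_mktuple (bigD1 i) //= mxE eqxx scale1r.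
by rewrite big1 ?addr0 // => j /negPf ne_ji; rewrite mxE eq_sym ne_ji scale0r.
Qed.

(** No invertibility is assumed: [invmx] is the identity on singular matrices,
    so a polynomial fixed by all elements of a set of matrices is fixed by
    everything in its [gen_group]. *)
Lemma mx_act_invmx (A : 'M[k]_3) f : mx_act A f = f -> mx_act (invmx A) f = f.
Proof.
move=> fixA; have [unitA | /invmx_out->//] := boolP (A \in unitmx).
by rewrite -{1}fixA -mx_act_mul mulmxV // mx_act1.
Qed.

Lemma invariant_gen_group (S : 'M[k]_3 -> Prop) f :
  (forall A, S A -> mx_act A f = f) -> Defs.invariant (gen_group S) f.
Proof.
move=> fixS A; elim=> [{}A /fixS // | | {}A B _ fixA _ fixB | {}A _ fixA].
- exact: mx_act1.
- by rewrite mx_act_mul fixA.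
- exact: mx_act_invmx.
Qed.

(** Since D is finite, the elements whose image fixes f form a subgroup as soon
    as they are closed under products. *)
Lemma rep_fixed_gen (gT : finGroupType) (D : {group gT}) (T : {set gT})
    (rho : mx_representation k D 3) f :
  D :=: <<T>>%g -> (forall g, g \in T -> mx_act (rho g) f = f) ->
  forall g, g \in D -> mx_act (rho g) f = f.
Proof.
move=> defD fixT g Dg.
suff grp : group_set [set x in D | mx_act (rho x) f == f].
  have sTG: (<<T>> \subset Group grp)%g.
    rewrite gen_subG; apply/subsetP => x Tx.
    by rewrite inE fixT // eqxx andbT defD mem_gen.
  have: g \in Group grp by apply: (subsetP sTG); rewrite -defD.
  by rewrite inE => /andP[_ /eqP].
apply/group_setP; split=> [|x y]; rewrite !inE.
  by rewrite group1 repr_mx1 mx_act1 eqxx.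
case/andP=> Dx /eqP fixx /andP[Dy /eqP fixy].
by rewrite groupM // repr_mxM // mx_act_mul fixx fixy eqxx.
Qed.

Lemma mx_act_diag_mono u v w c0 c1 c2 :
  mx_act (diag3 u v w) (mono k c0 c1 c2)
    = (u ^+ c0 * v ^+ c1 * w ^+ c2) *: mono k c0 c1 c2.
Proof.
have actX i : mx_act (diag3 u v w) 'X_i = [:: u; v; w]`_i *: 'X_i.
  rewrite mx_actX (bigD1 i) //= !mxE eqxx big1 ?addr0 // => j /negPf ne_ji.
  by rewrite !mxE eq_sym ne_ji scale0r.
rewrite /mono /x0 /x1 /x2 /mx_act !rmorphM !rmorphXn /= -!/(mx_act _ _) !actX /=.
rewrite !exprZn -!scalerAl -!scalerAr !scalerA -!scalerAl !scalerA.
by congr (_ *: _); ring.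
Qed.

Lemma mcoeff_diag u v w f m :
  (mx_act (diag3 u v w) f)@_m
    = (u ^+ m 0 * v ^+ m 1 * w ^+ m 2%:R) * f@_m.
Proof.
rewrite mx_actE [in RHS](mpolyE f) !raddf_sum /= mulr_sumr.
apply: eq_bigr => m' _; rewrite mx_act_diag_mono.
rewrite !mcoeffZ mcoeff_mono mcoeffX -mnm3_ext.
by case: eqP => [-> | _]; rewrite ?mulr0 ?mulr1 // mulrC.
Qed.

Lemma mx_act_eta_mono c0 c1 c2 :
  mx_act (rho_eta k) (mono k c0 c1 c2) = mono k c0 c2 c1.
Proof.
have actX i : mx_act (rho_eta k) 'X_i = 'X_(tperm (1 : 'I_3) 2%:R i).
  rewrite mx_actX (bigD1 (tperm (1 : 'I_3) 2%:R i)) //= !mxE eqxx scale1r.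
  by rewrite big1 ?addr0 // => j /negPf ne_ji; rewrite !mxE eq_sym ne_ji scale0r.
rewrite /mono /x0 /x1 /x2 /mx_act !rmorphM !rmorphXn /= -!/(mx_act _ _) !actX.
by rewrite tpermL tpermR tpermD // mulrAC.
Qed.


(** * Subalgebras generated by a set *)

Lemma gen_algebra_scale (S : R -> Prop) c f :
  gen_algebra S f -> gen_algebra S (c *: f).
Proof.
move=> Sf; rewrite -mul_mpolyC.
by apply: gen_algebra_mul => //; exact: gen_algebra_const.
Qed.

Lemma gen_algebra_sub (S : R -> Prop) f g :
  gen_algebra S f -> gen_algebra S g -> gen_algebra S (f - g).
Proof.
move=> Sf Sg; apply: gen_algebra_add => //.
by rewrite -scaleN1r; exact: gen_algebra_scale.
Qed.

Lemma gen_algebra_sum (S : R -> Prop) (I : eqType) (r : seq I) (F : I -> R) :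
  (forall i, i \in r -> gen_algebra S (F i)) -> gen_algebra S (\sum_(i <- r) F i).
Proof.
move=> SF; rewrite big_seq; apply: (big_ind (gen_algebra S)) => //.
- by rewrite -mpolyC0; exact: gen_algebra_const.
- exact: gen_algebra_add.
Qed.

Lemma gen_algebra_invariant (G : 'M[k]_3 -> Prop) (S : R -> Prop) f :
  (forall s, S s -> Defs.invariant G s) -> gen_algebra S f -> Defs.invariant G f.
Proof.
move=> invS Sf A GA.
elim: Sf => [s /invS/(_ A GA)// | c | g h _ IHg _ IHh | g h _ IHg _ IHh].
- exact: comp_mpolyC.
- by rewrite -[in RHS]IHg -[in RHS]IHh; exact: comp_mpolyD.
- by rewrite -[in RHS]IHg -[in RHS]IHh; exact: rmorphM.
Qed.

(** Polynomials supported on a submonoid N of exponents form a subalgebra, so an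
    algebra having a member with support outside N needs a generator with
    support outside N.  Stated positively, this produces the generator
    without case analysis on membership in S. *)
Lemma gen_algebra_msupp (S : R -> Prop) (N : pred 'X_{1.. 3}) f m :
    N 0%MM -> (forall m1 m2, N m1 -> N m2 -> N (m1 + m2)%MM) ->
    gen_algebra S f -> m \in msupp f -> ~~ N m ->
  exists s m', [/\ S s, m' \in msupp s & ~~ N m'].
Proof.
move=> N0 ND Sf; elim: Sf m => [s Ss | c | g h _ IHg _ IHh | g h _ IHg _ IHh] m.
- by move=> sm NNm; exists s, m.
- by rewrite msuppC; case: ifP => // _; rewrite inE => /eqP-> /negP.
- by move/msuppD_le; rewrite mem_cat => /orP[/IHg | /IHh]; apply.
- move/msuppM_le => /allpairsP[[m1 m2] /= [gm1 hm2 ->]] NNm.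
  have [Nm1 | NNm1] := boolP (N m1); last exact: IHg NNm1.
  have [Nm2 | NNm2] := boolP (N m2); last exact: IHh NNm2.
  by rewrite ND in NNm.
Qed.

End PolynomialActions.

(** * Exponents of the monomials fixed by the rotations *)

(** Modulo d the weight a c1 + (d - a) c2 is a (c1 - c2), and a is invertible. *)
Lemma dvdn_dihedral_weight {a d} c1 c2 : coprime a d -> (a <= d)%N ->
  (d %| a * c1 + (d - a) * c2)%N = (c1 == c2 %[mod d])%N.
Proof.
move=> co_ad le_ad.
have red b1 b2 : (b2 <= b1)%N -> (a * b1 == a * b2 %[mod d])%N = (b1 == b2 %[mod d])%N.
  move=> le_b; rewrite !eqn_mod_dvd ?leq_mul2l ?le_b ?orbT //.
  by rewrite -mulnBr Gauss_dvdr // coprime_sym.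
(* Adding a * c2 to both sides avoids the truncated subtraction. *)
rewrite /dvdn -[X in _ == X](mod0n d) -(eqn_modDr (a * c2)) add0n -addnA -mulnDl.
rewrite subnK // addnC mulnC modnMDl.
by case/orP: (leq_total c2 c1) => [/red // | /red]; rewrite eq_sym [RHS]eq_sym.
Qed.

Section Generation.

Context {k : closedFieldType} {d : nat} {e : k} (prim_e : d.-primitive_root e).

Local Notation R := {mpoly k[3]}.
Local Notation B := (B2d e d).
Local Notation gen := (gen_algebra B).

(** The character by which [rho_tau e a d] scales a monomial; the condition does
    not depend on a, which is why Gamma and the rotation subgroup of D fix the
    same monomials. *)
Lemma weight_eq1 {a} c0 c1 c2 : coprime a d -> (a <= d)%N ->
  (1 ^+ c0 * (e ^+ a) ^+ c1 * (e ^+ (d - a)) ^+ c2 == 1)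
    = (c1 == c2 %[mod d])%N.
Proof.
move=> co_ad le_ad; rewrite expr1n mul1r -!exprM -exprD.
by rewrite -(dvdn_dihedral_weight c1 c2 co_ad le_ad) (prim_order_dvd prim_e).
Qed.

Lemma d_gt0 : (0 < d)%N.
Proof. exact: prim_order_gt0 prim_e. Qed.

Lemma Gamma_gen_eq : diag3 1 e (e ^+ d.-1) = rho_tau e 1 d.
Proof. by rewrite /rho_tau expr1 subn1. Qed.

Lemma mono_neq0 c0 c1 c2 : mono k c0 c1 c2 != 0.
Proof. by rewrite -msupp_eq0 monoE msuppX. Qed.

Lemma invariant_Gamma_mono c0 c1 c2 :
  Defs.invariant (Gamma e d) (mono k c0 c1 c2) <-> (c1 = c2 %[mod d])%N.
Proof.
have w1 := weight_eq1 c0 c1 c2 (coprime1n d) d_gt0.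
split=> [invc | eq_c].
  have := invc _ (gen_group_mem (erefl (diag3 1 e (e ^+ d.-1)))).
  rewrite Gamma_gen_eq mx_act_diag_mono => /eqP; rewrite -subr_eq0.
  rewrite -{2}[mono _ _ _ _]scale1r -scalerBl scaler_eq0 (negPf (mono_neq0 _ _ _)).
  by rewrite orbF subr_eq0 w1 => /eqP.
apply: invariant_gen_group => _ ->; rewrite Gamma_gen_eq mx_act_diag_mono.
by move/eqP: eq_c; rewrite -w1 => /eqP->; rewrite scale1r.
Qed.

(** * Generation by the invariants of degree 2d *)

Lemma gen_diag_mono p q : (p + 2 * q = 2 * d)%N -> gen (mono k p q q).
Proof.
move=> deg; apply: gen_algebra_mem; left; exists q; first by lia.
by congr (mono k _ _ _); lia.
Qed.

Lemma gen_binomial c0 c1 c2 :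
    (c0 + c1 + c2 = 2 * d)%N -> c1 <> c2 -> (c1 = c2 %[mod d])%N ->
  gen (mono k c0 c1 c2 + mono k c0 c2 c1).
Proof.
move=> deg ne_c eq_c; apply: gen_algebra_mem; right; exists c0, c1, c2.
by split=> //; apply/invariant_Gamma_mono.
Qed.

Lemma monoD c0 c1 c2 b0 b1 b2 :
  mono k (c0 + b0) (c1 + b1) (c2 + b2) = mono k c0 c1 c2 * mono k b0 b1 b2.
Proof. by rewrite /mono !exprD; ring. Qed.

(** A monomial x0^p (x1 x2)^q of degree 2dt splits into t factors of degree 2d:
    taking as many factors x1 x2 as fit, the rest is filled with x0, because the
    total degree is large enough and p is even. *)
Lemma gen_diag t p q : (p + 2 * q = 2 * d * t)%N -> gen (mono k p q q).
Proof.
elim: t p q => [|t IHt] p q deg.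
  have [-> ->] : p = 0%N /\ q = 0%N by lia.
  by rewrite /mono !expr0 !mulr1 -mpolyC1; exact: gen_algebra_const.
pose q' := minn q d; pose p' := (2 * d - 2 * q')%N.
have [-> ->] : p = (p' + (p - p'))%N /\ q = (q' + (q - q'))%N.
  by rewrite /p' /q'; have := d_gt0; split; nia.
rewrite monoD; apply: gen_algebra_mul; first by apply: gen_diag_mono; lia.
by apply: IHt; rewrite /p' /q'; nia.
Qed.

(** This is x0^p (x1 x2)^q (x1^(dr) + x2^(dr)). *)
Definition orbit_sum p q r : R := mono k p (q + d * r) q + mono k p q (q + d * r).

Lemma orbit_sum_mull p q p' q' r :
  orbit_sum (p + p') (q + q') r = mono k p q q * orbit_sum p' q' r.
Proof. by rewrite /orbit_sum -!addnA !monoD mulrDr. Qed.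

(** The recursion for p_r = x1^(dr) + x2^(dr): expanding p_2 p_r gives p_(r+2)
    and two cross terms, which are mirror images of each other. *)
Lemma orbit_sum_rec p q r :
  orbit_sum p q (r + 2) =
    orbit_sum 0 0 2 * orbit_sum p q r - mono k p (q + d * r) (q + 2 * d)
                                      - mono k p (q + 2 * d) (q + d * r).
Proof.
rewrite /orbit_sum /mono !add0n (mulnC d 2) (mulnDr d r 2) (mulnC d 2).
by move: (2 * d)%N => n; rewrite !exprD !expr0; ring.
Qed.

(** Strong induction on r; the cross terms of [orbit_sum_rec] have the same
    degree and a strictly smaller r. *)
Lemma gen_orbit_sum t p q r :
  (p + 2 * q + d * r = 2 * d * t)%N -> gen (orbit_sum p q r).
Proof.
have d0 := d_gt0.
have genP2 : gen (orbit_sum 0 0 2).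
  by apply: gen_binomial; [lia | lia | rewrite add0n modnMr mod0n].
elim/ltn_ind: r t p q => -[|[|[|r]]] IHr t p q deg.
- by rewrite /orbit_sum muln0 addn0; apply: gen_algebra_add; apply: (@gen_diag t); lia.
- case: t => [|t] in deg *; first by lia.
  (* The degree-2d factor x0^p' (x1 x2)^q' p_1 has p' + 2 q' = d; when d is
     odd this needs p' > 0, and then p is odd as well. *)
  pose q' := minn q d./2; pose p' := (d - 2 * q')%N.
  have [Ep Eq] : p = ((p - p') + p')%N /\ q = ((q - q') + q')%N.
    by rewrite /p' /q'; lia.
  rewrite Ep Eq orbit_sum_mull; apply: gen_algebra_mul.
    by apply: (@gen_diag t); rewrite /p' /q'; lia.
  by apply: gen_binomial; [rewrite /p' /q'; lia | lia | rewrite muln1 modnDr].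
- case: t => [|t] in deg *; first by lia.
  rewrite -[p]addn0 -[q]addn0 orbit_sum_mull; apply: gen_algebra_mul => //.
  by apply: (@gen_diag t); lia.
(* For r + 3, the cross terms form a power of x1 x2 times p_1 if r = 0 and
   times p_(r-1) otherwise. *)
case: t => [|t] in deg *; first by lia.
rewrite -addn2 orbit_sum_rec -addrA -opprD; apply: gen_algebra_sub.
  by apply: gen_algebra_mul => //; apply: (IHr r.+1 _ t) => //; lia.
case: r => [|r] in IHr deg *.
  have -> : mono k p (q + d * 1) (q + 2 * d) + mono k p (q + 2 * d) (q + d * 1)
            = orbit_sum p (q + d) 1.
    by rewrite addrC /orbit_sum; congr (mono k _ _ _ + mono k _ _ _); lia.
  by apply: (IHr 1%N _ t.+1) => //; lia.
have -> : mono k p (q + d * r.+2) (q + 2 * d) + mono k p (q + 2 * d) (q + d * r.+2)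
          = orbit_sum p (q + 2 * d) r.
  by rewrite /orbit_sum; congr (mono k _ _ _ + mono k _ _ _); lia.
by apply: (IHr r _ t.+1) => //; lia.
Qed.

Lemma gen_symmetrized_mono c0 c1 c2 :
    (2 * d %| c0 + c1 + c2)%N -> (c1 = c2 %[mod d])%N ->
  gen (mono k c0 c1 c2 + mono k c0 c2 c1).
Proof.
wlog le_c : c1 c2 / (c2 <= c1)%N => [IH | /dvdnP[t deg] /eqP].
  case/orP: (leq_total c2 c1) => [/IH // | le_c deg eq_c].
  by rewrite addrC; apply: IH => //; rewrite addnAC.
rewrite eqn_mod_dvd // => /dvdnP[r eq_c].
have -> : c1 = (c2 + d * r)%N by lia.
by apply: (@gen_orbit_sum t); nia.
Qed.


(** * Minimality of the generating set *)

Definition B2d_member (m : 'X_{1.. 3}) : R :=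
  mono k (m 0) (m 1) (m 2%:R)
    + (if m 1 == m 2%:R then 0 else mono k (m 0) (m 2%:R) (m 1)).

Lemma B2d_msupp_degree f m : B f -> m \in msupp f -> mdeg m = (2 * d)%N.
Proof.
case=> [[i le_id ->] | [c0 [c1 [c2 [deg _ _ ->]]]]].
  by rewrite monoE msuppX inE => /eqP->; rewrite mdeg_mnm3; lia.
move/msuppD_le; rewrite !monoE !msuppX mem_cat !inE.
by case/orP=> /eqP->; rewrite mdeg_mnm3; lia.
Qed.

Lemma B2d_determined f m : B f -> m \in msupp f -> f = B2d_member m.
Proof.
case=> [[i _ ->] | [c0 [c1 [c2 [_ /eqP/negPf ne_c _ ->]]]]].
  rewrite monoE msuppX inE => /eqP->.
  by rewrite /B2d_member !mnmE /= eqxx addr0 monoE.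
move/msuppD_le; rewrite [in msupp _]monoE [in X in _ ++ X]monoE !msuppX.
rewrite mem_cat !inE; case/orP=> /eqP->; rewrite /B2d_member !mnmE /=.
  by rewrite ne_c.
by rewrite eq_sym ne_c addrC.
Qed.

Lemma B2d_msupp_nonempty f : B f -> exists m, m \in msupp f.
Proof.
case=> [[i _ ->] | [c0 [c1 [c2 [_ /eqP/negPf ne_c _ ->]]]]].
  by exists (mnm3 (2 * d - 2 * i) i i); rewrite monoE msuppX inE.
exists (mnm3 c0 c1 c2); rewrite mcoeff_msupp mcoeffD !mcoeff_mono eqxx.
by rewrite mnm3_eq ne_c !andbF addr0 oner_eq0.
Qed.

(** The submonoid N of exponents other than m that are 0 or of degree at least
    2d contains every exponent of a member of B_2d except m itself.  It
    is closed under addition because m has degree 2d, so it is not a sum of two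
    exponents of degree at least 2d. *)
Lemma B2d_irredundant (S : R -> Prop) f :
  (forall s, S s -> B s) -> B f -> gen_algebra S f -> S f.
Proof.
move=> SB Bf Sf; have [m fm] := B2d_msupp_nonempty _ Bf.
have deg_m := B2d_msupp_degree _ _ Bf fm; have d0 := d_gt0.
pose N := [pred m' : 'X_{1.. 3} |
            (m' != m) && ((m' == 0%MM) || (2 * d <= mdeg m')%N)].
have N0 : N 0%MM by rewrite /= eqxx andbT eq_sym -mdeg_eq0 deg_m; lia.
have ND m1 m2 : N m1 -> N m2 -> N (m1 + m2)%MM.
  move=> /= /andP[ne1 /orP[/eqP-> | deg1]]; first by rewrite add0m.
  case/andP=> ne2 /orP[/eqP-> | deg2]; first by rewrite addm0 ne1 deg1 orbT.
  rewrite mdegD; apply/andP; split; last by lia.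
  by apply/eqP => def_m; move: deg_m; rewrite -def_m mdegD; lia.
have NNm : ~~ N m by rewrite /= eqxx.
have [s [m' [Ss sm' NNm']]] := gen_algebra_msupp _ _ _ _ N0 ND Sf fm NNm.
have m'm : m' = m.
  apply/eqP; move: NNm'; rewrite /= (B2d_msupp_degree _ _ (SB _ Ss) sm') leqnn.
  by rewrite orbT andbT negbK.
rewrite {}m'm in sm'.
by rewrite (B2d_determined _ _ Bf fm) -(B2d_determined _ _ (SB _ Ss) sm').
Qed.

End Generation.

(** * Invariants of the extended dihedral group *)

Section DihedralInvariants.

Context {k : closedFieldType} {d a : nat} {eps : k}.
Context (le_ad : (a <= d)%N) (co_ad : coprime a d).
Context (prim_eps : (2 * d).-primitive_root eps).
Context {gT : finGroupType} {D : {group gT}} {tau eta : gT}.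
Context (dihedralD : is_dihedral D d tau eta).
Context {rho : mx_representation k D 3}.
Context (rhoE : is_rho tau eta (eps ^+ 2) a d rho).

Local Notation R := {mpoly k[3]}.
Local Notation e := (eps ^+ 2).
Local Notation B := (B2d e d).

Lemma primitive_root_sqr : d.-primitive_root e.
Proof. by have := exp_prim_root prim_eps 2; rewrite gcdnMr mulKn. Qed.

Lemma scalar_mx_diag3 (c : k) : c%:M = diag3 c c c.
Proof.
apply/matrixP => i j; rewrite !mxE; case: eqP => // _.
by case: i => [[|[|[|//]]]].
Qed.

Lemma invariant_DbarP (f : R) :
  Defs.invariant (Dbar rho eps) f <->
    [/\ mx_act (rho_tau e a d) f = f, mx_act (rho_eta k) f = f
      & mx_act eps%:M f = f].
Proof.
have [defD _ _ _ _] := dihedralD; have [rho_t rho_e] := rhoE.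
have Dt : tau \in D by rewrite defD mem_gen // !inE eqxx.
have De : eta \in D by rewrite defD mem_gen // !inE eqxx orbT.
split=> [invf | [fix_t fix_e fix_s]].
  split; apply: invf; apply: gen_group_mem.
  - by left; exists tau.
  - by left; exists eta.
  - by right; exact: gen_group_mem.
apply: invariant_gen_group => A [[g Dg ->] | ].
  apply: (rep_fixed_gen _ _ _ _ _ defD) Dg => h.
  by rewrite !inE => /orP[] /eqP->; rewrite ?rho_t ?rho_e.
by move: A; apply: invariant_gen_group => _ ->.
Qed.

Lemma B2d_invariant f : B f -> Defs.invariant (Dbar rho eps) f.
Proof.
have torus c0 c1 c2 : (c0 + c1 + c2 = 2 * d)%N -> (c1 = c2 %[mod d])%N ->
    mx_act (rho_tau e a d) (mono k c0 c1 c2) = mono k c0 c1 c2 /\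
    mx_act eps%:M (mono k c0 c1 c2) = mono k c0 c1 c2.
  move=> deg eq_c; rewrite scalar_mx_diag3 !mx_act_diag_mono; split.
    move/eqP: eq_c.
    rewrite -(weight_eq1 primitive_root_sqr c0 _ _ co_ad le_ad) => /eqP->.
    exact: scale1r.
  by rewrite -!exprD deg (prim_expr_order prim_eps) scale1r.
case=> [[i le_id ->] | [c0 [c1 [c2 [deg _ inv_c ->]]]]]; apply/invariant_DbarP.
  have [|//|fix_t fix_s] := torus (2 * d - 2 * i)%N i i; first by lia.
  by split=> //; exact: mx_act_eta_mono.
have eq_c := (invariant_Gamma_mono primitive_root_sqr _ _ _).1 inv_c.
have [fix_t fix_s] := torus _ _ _ deg eq_c.
have [||fix_t' fix_s'] := torus c0 c2 c1; [by lia | by [] |].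
split; rewrite /mx_act comp_mpolyD -!/(mx_act _ _).
- by rewrite fix_t fix_t'.
- by rewrite !mx_act_eta_mono addrC.
- by rewrite fix_s fix_s'.
Qed.

Lemma invariant_msupp (f : R) m :
  Defs.invariant (Dbar rho eps) f -> m \in msupp f ->
  (2 * d %| m 0%R + m 1%R + m 2%:R%R)%N /\ (m 1%R = m 2%:R%R %[mod d])%N.
Proof.
move=> /invariant_DbarP[fix_t _ fix_s]; rewrite mcoeff_msupp => fm.
have weight1 u v w : mx_act (diag3 u v w) f = f ->
    u ^+ m 0 * v ^+ m 1 * w ^+ m 2%:R == 1.
  move=> fix_f; apply/eqP/(mulIf fm).
  by rewrite -mcoeff_diag fix_f mul1r.
split.
  rewrite (prim_order_dvd prim_eps) !exprD.
  by apply: weight1; rewrite -scalar_mx_diag3.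
by apply/eqP; rewrite -(weight_eq1 primitive_root_sqr (m 0) _ _ co_ad le_ad) weight1.
Qed.

(** Characteristic different from 2 enters by averaging over the transposition:
    f = (f + eta f) / 2 turns the expansion of f into monomials into a
    combination of symmetrized monomials. *)
Lemma invariant_gen_B2d (f : R) : (2%:R != 0 :> k) ->
  Defs.invariant (Dbar rho eps) f -> gen_algebra B f.
Proof.
move=> nz2 inv_f; have [_ fix_e _] := (invariant_DbarP f).1 inv_f.
have -> : f = 2%:R^-1 *: (f + mx_act (rho_eta k) f).
  by rewrite fix_e -mulr2n -scaler_nat scalerA mulVf // scale1r.
apply: gen_algebra_scale; rewrite mx_actE [X in X + _]mpoly3E -big_split /=.
apply: gen_algebra_sum => m /(invariant_msupp f m inv_f)[dvd_m eq_m].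
rewrite -scalerDr mx_act_eta_mono; apply: gen_algebra_scale.
exact: (gen_symmetrized_mono primitive_root_sqr).
Qed.

End DihedralInvariants.

Theorem theorem3p7
  (k : closedFieldType) (hchar : [pchar k] =i pred0)
  (d a : nat) (hd : (3 <= d)%N) (ha0 : (0 < a)%N) (had : (2 * a < d)%N)
  (hcop : coprime a d)
  (eps : k) (heps : (2 * d).-primitive_root eps)
  (gT : finGroupType) (D : {group gT}) (tau eta : gT)
  (hD : is_dihedral D d tau eta)
  (rho : mx_representation k D 3)
  (hrho : is_rho tau eta (eps ^+ 2) a d rho) :
  fundamental_invariants (Dbar rho eps) (B2d (eps ^+ 2) d).
Proof.
have le_ad : (a <= d)%N by lia.
have nz2 : 2%:R != 0 :> k by have := hchar 2%N; rewrite !inE /= => /negbT.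
have inv_B f : B2d (eps ^+ 2) d f -> Defs.invariant (Dbar rho eps) f.
  exact: (B2d_invariant le_ad hcop heps hD hrho).
have genB : generates_invariants (Dbar rho eps) (B2d (eps ^+ 2) d).
  move=> f; split; first exact: gen_algebra_invariant.
  exact: (invariant_gen_B2d le_ad hcop heps hD hrho).
split=> // S SB genS f Bf.
apply: (B2d_irredundant (primitive_root_sqr heps) S f SB Bf).
by apply/genS/inv_B.
Qed.
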